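(* Let $\lambda,\mu,\nu\in\mathcal{P}_n$. If $l(\mu)+l(\nu)\leq n$, then $$\mathbf{B}_{n}^{\mathfrak{so}_{2n}}(\nu)_{\mu}^{\lambda}=\mathbf{B}_{n}^{\mathfrak{sp}_{2n}}(\nu)_{\mu}^{\lambda}.$$
   Context: $\mathcal{P}_n$ is the set of Young diagrams $\lambda=(\lambda_1\ge\dots\ge\lambda_n\ge0)$ with at most $n$ rows; $l(\lambda)$ is the number of nonzero rows. Positions in columns are counted from the top. The far-eastern reading $\mathrm{FE}(T)$ of a tableau is the sequence of its entries read from the rightmost column to the leftmost column, each column from top to bottom. **Adding letters.** For $i\in\{1,\dots,n\}$, $\lambda[i]$ (resp. $\lambda[\bar i]$) is obtained from $\lambda$ by adding $1$ to (resp. subtracting $1$ from) $\lambda_i$; $\lambda[m_1,\dots,m_k]:=\lambda[m_1,\dots,m_{k-1}][m_k]$. A sequence $m_1,\dots,m_N$ is smooth on a Young diagram $\lambda$ if $\lambda[m_1,\dots,m_k]$ is a Young diagram (weakly decreasing with nonnegative entries) for all $k=1,\dots,N$. **Type $C_n$.** Letters $1\prec\cdots\prec n\prec\bar n\prec\cdots\prec\bar 1$. A $C_n$-semistandard tableau has weakly increasing rows and strictly increasing columns. It is KN-admissible if: (C1) whenever a column of length $N$ has $a\in\{1,\dots,n\}$ at position $p$ and $\bar b$ at position $q$, then $(q-p)+\max(a,b)>N$; (C2) whenever two adjacent columns (left, right) and $p\le q<r\le s$, $a_1\le b_1$, $a_2\le b_2$ in $\{1,\dots,n\}$ are such that either [left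 has $a_1$ at $p$; right has $b_1$ at $q$, $\overline{b_2}$ at $r$, $\overline{a_2}$ at $s$] or [left has $a_1$ at $p$, $b_1$ at $q$, $\overline{b_2}$ at $r$; right has $\overline{a_2}$ at $s$], then $(q-p)+(s-r)<\max(b_1,b_2)-\min(a_1,a_2)$. $\mathcal{B}^{\mathfrak{sp}_{2n}}(\nu)$ is the set of KN-admissible $C_n$-semistandard tableaux of shape $\nu$, and $\mathbf{B}_{n}^{\mathfrak{sp}_{2n}}(\nu)_{\mu}^{\lambda}$ is the set of $T\in\mathcal{B}^{\mathfrak{sp}_{2n}}(\nu)$ with $\mathrm{FE}(T)$ smooth on $\mu$ and $\mu[\mathrm{FE}(T)]=\lambda$. **Type $D_n$ (no spin columns).** Letters $\{1,\dots,n,\bar n,\dots,\bar 1\}$ with the order $1\prec\cdots\prec n-1\prec n,\bar n\prec\overline{n-1}\prec\cdots\prec\bar 1$, where $n$ and $\bar n$ are incomparable. A $D_n$-tableau of shape $\nu\in\mathcal{P}_n$ (a filling by these letters) is semistandard if entries in each row are weakly increasing and $n,\bar n$ do not both appear in the same row, and entries in each column are strictly increasing except that $n$ and $\bar n$ may appear successively (vertically adjacent entries $u$ above $v$ satisfy $u\prec v$ or $\{u,v\}=\{n,\bar n\}$). A Young diagram $\nu\in\mathcal{P}_n$ is taken to represent the dominant integral weight $\nu_1\epsilon_1+\dots+\nu_n\epsilon_n$ with $\nu_n\ge 0$, and $T^{+}$ denotes the part of $T$ consisting of its columns of length $n$. $T$ is KN-admissible if: (D1) whenever a column of length $N$ has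 $i\in\{1,\dots,n\}$ at position $p$ and $\bar i$ at position $q>p$, then $(q-p)+i>N$. (D2) if a column of $T^{+}$ has $n$ (resp. $\bar n$) as its $k$-th entry, then $n-k$ is even (resp. odd). (D4) whenever two adjacent columns and $p\le q<r\le s$, $a\le b<n$ are such that either [left has $a$ at $p$; right has $b$ at $q$, $\bar b$ at $r$, $\bar a$ at $s$] or [left has $a$ at $p$, $b$ at $q$, $\bar b$ at $r$; right has $\bar a$ at $s$], then $(q-p)+(s-r)<b-a$. (D5) whenever two adjacent columns, $p\le q<r=q+1\le s$ and $a<n$ are such that, for $(u,v)=(n,\bar n)$ or $(\bar n,n)$, either [left has $a$ at $p$; right has $u$ at $q$, $v$ at $r$, $\bar a$ at $s$] or [left has $a$ at $p$, $u$ at $q$, $v$ at $r$; right has $\bar a$ at $s$], then $(q-p)+(s-r)=s-p-1<n-a$. (D6) there are no two adjacent columns and $p<s$ such that the left column has an entry in $\{n,\bar n\}$ at position $p$ and the right column has an entry in $\{n,\bar n\}$ at position $s$. (D7) whenever two adjacent columns, $p\le q<r\le s$ and $a<n$ are such that the left column has $a$ at $p$ and $u\in\{n,\bar n\}$ at $r$, the right column has $v\in\{n,\bar n\}$ at $q$ and $\bar a$ at $s$, and either [$u\ne v$ and $r-q+1$ is odd] or [$u=v$ and $r-q+1$ is even], then $s-p<n-a$. $\mathcal{B}^{\mathfrak{so}_{2n}}(\nu)$ is the set of KN-admissible semistandard $D_n$-tableaux of shape $\nu$, and $\mathbf{B}_{n}^{\mathfrak{so}_{2n}}(\nu)_{\mu}^{\lambda}$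 is the set of $T\in\mathcal{B}^{\mathfrak{so}_{2n}}(\nu)$ with $\mathrm{FE}(T)$ smooth on $\mu$ and $\mu[\mathrm{FE}(T)]=\lambda$. The equality in the claim is equality of sets of fillings of $\nu$. *)

(* Defs.v *)
From HB Require Import structures.
From mathcomp Require Import all_boot all_order all_algebra.
From mathcomp Require Import boolp classical_sets.

Set Implicit Arguments.
Unset Strict Implicit.
Unset Printing Implicit Defensive.

Import Order.TTheory GRing.Theory Num.Theory.

Local Open Scope ring_scope.

(** Rows, columns and positions inside columns are numbered from 0.  Letters
    keep their values 1, ..., n: the element [i : 'I_n] stands for the value
    [i.+1]. *)

Section Diagrams.

Variable n : nat.

Definition weight := {ffun 'I_n -> int}.

Definition is_diagram (w : weight) : bool :=
  [forall i, 0 <= w i] &&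
  [forall i : 'I_n, forall j : 'I_n, (i <= j)%N ==> (w j <= w i)].

Record diagram := Diagram {
  rows :> {ffun 'I_n -> int};
  diagramP : is_diagram rows
}.

Definition num_rows (lam : diagram) : nat := #|[pred i | lam i != 0]|.

(** Entries of a diagram are nonnegative, so this is [nu i] as a natural. *)
Definition row_len (nu : diagram) (i : 'I_n) : nat := `|nu i|%N.

Definition col_len (nu : diagram) (j : nat) : nat :=
  #|[pred i | (j < row_len nu i)%N]|.

Definition num_cols (nu : diagram) : nat := (\max_(i < n) row_len nu i)%N.

End Diagrams.

Section Letters.

Variable n : nat.

(** The boolean tells whether the letter is barred. *)
Definition letter := (bool * 'I_n)%type.

Definition unb (i : 'I_n) : letter := (false, i).
Definition bar (i : 'I_n) : letter := (true, i).

Definition value (i : 'I_n) : nat := i.+1.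

Definition is_n (x : letter) : bool := value x.2 == n.

Definition lt_C (x y : letter) : bool :=
  match x, y with
  | (false, i), (false, j) => (i < j)%N
  | (false, _), (true, _)  => true
  | (true, _),  (false, _) => false
  | (true, i),  (true, j)  => (j < i)%N
  end.

Definition le_C (x y : letter) : bool := (x == y) || lt_C x y.

(** The type D order only differs in that n and its bar are incomparable. *)
Definition lt_D (x y : letter) : bool := lt_C x y && ~~ (is_n x && is_n y).

Definition le_D (x y : letter) : bool := (x == y) || lt_D x y.

(** [n_pair x y] means that {x, y} consists of n and its bar. *)
Definition n_pair (x y : letter) : bool := [&& is_n x, is_n y & x != y].

Definition add_letter (w : weight n) (x : letter) : weight n :=
  [ffun i => w i + (if i == x.2 then (if x.1 then -1 else 1) else 0)].

Definition add_word (w : weight n) (s : seq letter) : weight n :=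
  foldl add_letter w s.

Definition smooth (w : weight n) (s : seq letter) : bool :=
  all (@is_diagram n) (scanl add_letter w s).

End Letters.

Section Fillings.

Variables (n : nat) (nu : diagram n).

Definition box := {i : 'I_n & 'I_(row_len nu i)}.

Definition filling := {ffun box -> letter n}.

Definition entry (T : filling) (p : 'I_n) (j : nat) : option (letter n) :=
  omap (fun c : 'I_(row_len nu p) =>
          T (Tagged (fun i => 'I_(row_len nu i)) c))
       (insub j).

Definition has_entry (T : filling) (j : nat) (p : 'I_n) (x : letter n) : Prop :=
  entry T p j = Some x.

Definition column (T : filling) (j : nat) : seq (letter n) :=
  pmap (fun p => entry T p j) (enum 'I_n).

Definition FE (T : filling) : seq (letter n) :=
  flatten [seq column T j | j <- rev (iota 0 (num_cols nu))].

(** In all the conditions below on a pair of adjacent columns, these are the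
    columns j (left) and j.+1 (right). *)

Definition semistandard_C (T : filling) : Prop :=
  (forall p j x y, has_entry T j p x -> has_entry T j.+1 p y -> le_C x y) /\
  (forall j (p q : 'I_n) x y, q = p.+1 :> nat ->
     has_entry T j p x -> has_entry T j q y -> lt_C x y).

(** The inequality is (q - p) + max(a, b) > N, written without subtraction. *)
Definition KN_C1 (T : filling) : Prop :=
  forall j (p q a b : 'I_n),
    has_entry T j p (unb a) -> has_entry T j q (bar b) ->
    (col_len nu j + p < q + maxn (value a) (value b))%N.

Definition KN_C2 (T : filling) : Prop :=
  forall j (p q r s a1 b1 a2 b2 : 'I_n),
    (p <= q < r)%N -> (r <= s)%N ->
    (value a1 <= value b1)%N -> (value a2 <= value b2)%N ->
    ([/\ has_entry T j p (unb a1), has_entry T j.+1 q (unb b1),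
         has_entry T j.+1 r (bar b2) & has_entry T j.+1 s (bar a2)] \/
     [/\ has_entry T j p (unb a1), has_entry T j q (unb b1),
         has_entry T j r (bar b2) & has_entry T j.+1 s (bar a2)]) ->
    ((q - p) + (s - r)
       < maxn (value b1) (value b2) - minn (value a1) (value a2))%N.

Definition semistandard_D (T : filling) : Prop :=
  [/\ forall p j x y, has_entry T j p x -> has_entry T j.+1 p y -> le_D x y,
      forall p j j' x y,
        has_entry T j p x -> has_entry T j' p y -> ~~ n_pair x y
    & forall j (p q : 'I_n) x y, q = p.+1 :> nat ->
        has_entry T j p x -> has_entry T j q y -> lt_D x y || n_pair x y].

Definition KN_D1 (T : filling) : Prop :=
  forall j (p q i : 'I_n), (p < q)%N ->
    has_entry T j p (unb i) -> has_entry T j q (bar i) ->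
    (col_len nu j < (q - p) + value i)%N.

(** The row [p] is the [p.+1]-th entry of the column. *)
Definition KN_D2 (T : filling) : Prop :=
  forall j (p : 'I_n) (x : letter n), col_len nu j = n ->
    has_entry T j p x -> is_n x -> odd (n - p.+1)%N = x.1.

Definition KN_D4 (T : filling) : Prop :=
  forall j (p q r s a b : 'I_n),
    (p <= q < r)%N -> (r <= s)%N -> (value a <= value b < n)%N ->
    ([/\ has_entry T j p (unb a), has_entry T j.+1 q (unb b),
         has_entry T j.+1 r (bar b) & has_entry T j.+1 s (bar a)] \/
     [/\ has_entry T j p (unb a), has_entry T j q (unb b),
         has_entry T j r (bar b) & has_entry T j.+1 s (bar a)]) ->
    ((q - p) + (s - r) < value b - value a)%N.

Definition KN_D5 (T : filling) : Prop :=
  forall j (p q r s a : 'I_n) (u v : letter n),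
    (p <= q)%N -> r = q.+1 :> nat -> (r <= s)%N -> (value a < n)%N ->
    n_pair u v ->
    ([/\ has_entry T j p (unb a), has_entry T j.+1 q u,
         has_entry T j.+1 r v & has_entry T j.+1 s (bar a)] \/
     [/\ has_entry T j p (unb a), has_entry T j q u,
         has_entry T j r v & has_entry T j.+1 s (bar a)]) ->
    ((q - p) + (s - r) < n - value a)%N.

Definition KN_D6 (T : filling) : Prop :=
  forall j (p s : 'I_n) (u v : letter n), (p < s)%N -> is_n u -> is_n v ->
    ~ (has_entry T j p u /\ has_entry T j.+1 s v).

Definition KN_D7 (T : filling) : Prop :=
  forall j (p q r s a : 'I_n) (u v : letter n),
    (p <= q < r)%N -> (r <= s)%N -> (value a < n)%N -> is_n u -> is_n v ->
    has_entry T j p (unb a) -> has_entry T j r u ->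
    has_entry T j.+1 q v -> has_entry T j.+1 s (bar a) ->
    (u != v /\ odd (r - q + 1)%N) \/ (u = v /\ ~~ odd (r - q + 1)%N) ->
    (s - p < n - value a)%N.

Local Open Scope classical_set_scope.

Definition tableaux_sp : set filling :=
  [set T | [/\ semistandard_C T, KN_C1 T & KN_C2 T]].

Definition tableaux_so : set filling :=
  [set T | semistandard_D T /\
           [/\ KN_D1 T, KN_D2 T & KN_D4 T] /\
           [/\ KN_D5 T, KN_D6 T & KN_D7 T]].

Definition smooth_from_to (mu lam : diagram n) : set filling :=
  [set T | smooth mu (FE T) /\ add_word mu (FE T) = lam].

Definition B_sp (mu lam : diagram n) : set filling :=
  tableaux_sp `&` smooth_from_to mu lam.

Definition B_so (mu lam : diagram n) : set filling :=
  tableaux_so `&` smooth_from_to mu lam.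

End Fillings.

Arguments tableaux_sp {n} nu.
Arguments tableaux_so {n} nu.
Arguments B_sp {n} nu mu lam.
Arguments B_so {n} nu mu lam.

(* Main.v *)
(** Smoothness forces every unbarred letter in row p to be at most l(mu) + p.
    Hence, when l(mu) + l(nu) <= n, the letter n occurs only at the bottom of
    columns of length l(nu) = n - l(mu), and its bar does not occur at all.
    The conditions special to type D that involve n or its bar then become
    vacuous or automatic, and (D1), (D4) are the cases a = b of (C1) and
    a1 = a2, b1 = b2 of (C2).  Conversely a violation of (C1) or (C2) yields one
    of this special kind: barred and unbarred letters with too few available
    values share a value, and suitably extremal shared values violate (D1) or
    (D4). *)

Require Import Defs.
From mathcomp Require Import all_boot all_order all_algebra.
From mathcomp Require Import boolp classical_sets.
From mathcomp Require Import zify.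

Set Implicit Arguments.
Unset Strict Implicit.
Unset Printing Implicit Defensive.

(** * Common values of strictly monotone sequences of naturals *)

Lemma increasing_gap (f : nat -> nat) (p q i j : nat) :
  (forall k, p <= k < q -> f k < f k.+1) ->
  p <= i -> i <= j -> j <= q -> f i + (j - i) <= f j.
Proof.
move=> f_lt le_pi; elim: j => [|j IHj] le_ij le_jq.
  by move: le_ij; rewrite leqn0 => /eqP ->; rewrite subnn addn0.
case: (ltngtP i j.+1) le_ij => // [lt_ij _ | -> _]; last by rewrite subnn addn0.
have := IHj lt_ij (ltnW le_jq); have := f_lt j; lia.
Qed.

Lemma decreasing_gap (g : nat -> nat) (r s i j : nat) :
  (forall k, r <= k < s -> g k.+1 < g k) ->
  r <= i -> i <= j -> j <= s -> g j + (j - i) <= g i.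
Proof.
move=> g_gt le_ri; elim: j => [|j IHj] le_ij le_js.
  by move: le_ij; rewrite leqn0 => /eqP ->; rewrite subnn addn0.
case: (ltngtP i j.+1) le_ij => // [lt_ij _ | -> _]; last by rewrite subnn addn0.
have := IHj lt_ij (ltnW le_js); have := g_gt j; lia.
Qed.

(* Both families take values in [A, B] and have more than B - A + 1 terms
   together; discarding the larger of the two current maxima until they agree
   finds the largest common value. *)
Lemma top_common_value (f g : nat -> nat) (p q r s A B : nat) :
  p <= q -> r <= s ->
  (forall k, p <= k < q -> f k < f k.+1) ->
  (forall k, r <= k < s -> g k.+1 < g k) ->
  A <= f p -> f q <= B -> A <= g s -> g r <= B ->
  B <= A + (q - p) + (s - r) ->
  exists i j, [/\ p <= i <= q, r <= j <= s, f i = g j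
                & (q - i) + (j - r) + f i <= B].
Proof.
move eqd: ((q - p) + (s - r)) => d.
elim: d q r B eqd => [|d IHd] q r B eqd le_pq le_rs f_lt g_gt Af fB Ag gB BA.
  have eqp : p = q by lia.
  have eqs : s = r by lia.
  by subst p s; exists q, r; split; lia.
have f_gap := increasing_gap f_lt (leqnn p) le_pq (leqnn q).
have g_gap := decreasing_gap g_gt (leqnn r) le_rs (leqnn s).
case: (ltngtP (f q) (g r)) => [lt_fg | lt_gf | eq_fg].
(* Discarding the larger maximum lowers the bound [B] to just below it, while the number of terms
   drops by one, so the counting hypothesis survives. The discarded family keeps a term: otherwise
   the other one alone would already reach [B]. *)
- have lt_rs : r < s by lia.
  have g1 := g_gt r.
  case: (IHd q r.+1 (g r).-1) => //; try lia.
    by move=> k kP; apply: g_gt; lia.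
  by move=> i [j [? ? ? ?]]; exists i, j; split; lia.
- have lt_pq : p < q by lia.
  have f1 : f q.-1 < f q by have := f_lt q.-1; rewrite prednK; lia.
  case: (IHd q.-1 r (f q).-1) => //; try lia.
    by move=> k kP; apply: f_lt; lia.
  by move=> i [j [? ? ? ?]]; exists i, j; split; lia.
- by exists q, r; split; lia.
Qed.

(** The reflection [x -> B - x] makes [g] increasing and [f] decreasing, and turns the largest
    common value into the smallest. *)
Lemma bottom_common_value (f g : nat -> nat) (p q r s A B : nat) :
  p <= q -> r <= s ->
  (forall k, p <= k < q -> f k < f k.+1) ->
  (forall k, r <= k < s -> g k.+1 < g k) ->
  A <= f p -> f q <= B -> A <= g s -> g r <= B ->
  B <= A + (q - p) + (s - r) ->
  exists i j, [/\ p <= i <= q, r <= j <= s, f i = g j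
                & A + (i - p) + (s - j) <= f i].
Proof.
move=> le_pq le_rs f_lt g_gt Af fB Ag gB BA.
have f_le k : p <= k <= q -> f k <= B.
  by move=> kP; have := increasing_gap (i := k) f_lt (j := q); lia.
have g_le k : r <= k <= s -> g k <= B.
  by move=> kP; have := decreasing_gap (j := k) g_gt (i := r); lia.
have [] := @top_common_value (fun k => B - g k) (fun k => B - f k)
             r s p q 0 (B - A) le_rs le_pq; try lia.
- by move=> k kP /=; have := g_gt k kP; have := g_le k; lia.
- by move=> k kP /=; have := f_lt k kP; have := f_le k.+1; lia.
move=> j [i [jP iP eq_fg le_A]]; exists i, j; have := f_le i iP.
move: eq_fg le_A => /=; have := g_le j jP; have := f_le p; split; lia.
Qed.

(* The letters of the barred and unbarred strips used for [a] lie below those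
   used for [b], so [b] is found above the smallest common value [a]. *)
Lemma nested_common_values (fa fb ga gb : nat -> nat) (p q r s A B : nat) :
  p <= q -> r <= s ->
  (forall k, p <= k < q -> fa k < fa k.+1) ->
  (forall k, p <= k < q -> fb k < fb k.+1) ->
  (forall k, r <= k < s -> ga k.+1 < ga k) ->
  (forall k, r <= k < s -> gb k.+1 < gb k) ->
  (forall k, p <= k <= q -> fa k <= fb k) ->
  (forall k, r <= k <= s -> ga k <= gb k) ->
  A <= fa p -> fb q <= B -> A <= ga s -> gb r <= B ->
  B <= A + (q - p) + (s - r) ->
  exists p' q' r' s',
    [/\ p <= p' <= q' /\ q' <= q, r <= r' <= s' /\ s' <= s,
        fa p' = ga s', fb q' = gb r' &
        fa p' <= fb q' <= fa p' + (q' - p') + (s' - r')].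
Proof.
move=> le_pq le_rs fa_lt fb_lt ga_gt gb_gt le_f le_g Af fB Ag gB BA.
have faq : fa q <= B by have := le_f q; lia.
have gar : ga r <= B by have := le_g r; lia.
have [p' [s' [p'P s'P eq_a le_a]]] :=
  bottom_common_value le_pq le_rs fa_lt ga_gt Af faq Ag gar BA.
have fb_p' := le_f p' p'P; have gb_s' := le_g s' s'P.
(* The search for [b] is confined to rows [p'..q] and [r..s'], with lower bound [fa p']. The bound
   [le_a] says that the rows given up are paid for by the rise from [A] to [fa p'], so there are
   still too many terms. *)
have [] := @top_common_value fb gb p' q r s' (fa p') B; try lia.
- by move=> k kP; apply: fb_lt; lia.
- by move=> k kP; apply: gb_gt; lia.
move=> q' [r' [q'P r'P eq_b le_b]]; exists p', q', r', s'.
have := @increasing_gap fb p q p' q' fb_lt.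
by split; lia.
Qed.

(** * Row and column lengths of a diagram as initial segments *)

Lemma down_closed_card (n : nat) (P : pred 'I_n) :
  (forall i j : 'I_n, i <= j -> P j -> P i) ->
  forall i : 'I_n, P i = (i < #|P|).
Proof.
move=> P_down i.
have card_lt (m : nat) : m <= n -> #|[pred j : 'I_n | j < m]| = m.
  move=> le_mn; have widen_inj : injective (widen_ord le_mn).
    by move=> x y /(congr1 val) /= /val_inj.
  rewrite -[RHS]card_ord -(card_imset _ widen_inj).
  rewrite -[RHS]cardsE; apply: eq_card => j; rewrite !inE.
  apply/idP/imsetP => [lt_jm | [k _ ->]]; last by rewrite /= ltn_ord.
  by exists (Ordinal lt_jm) => //; apply: val_inj.
(* If [P i] holds, [P] contains the [i.+1] indices up to [i]; if not, [P] is contained in the [i]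
   indices below [i]. *)
apply/idP/idP => [Pi | ].
  rewrite -[X in X <= _](card_lt i.+1 (ltn_ord i)); apply: subset_leq_card.
  by apply/fintype.subsetP => j; rewrite !inE ltnS => /P_down; apply.
apply: contraTT => nPi; rewrite -leqNgt.
rewrite -[X in _ <= X](card_lt i (ltnW (ltn_ord i))); apply: subset_leq_card.
apply/fintype.subsetP => j Pj; rewrite inE ltnNge; apply: contra nPi => le_ij.
exact: P_down le_ij Pj.
Qed.

Section Diagram.

Variables (n : nat) (nu : diagram n).

Lemma diagram_ge0 (i : 'I_n) : (0 <= nu i)%R.
Proof. by case/andP: (diagramP nu) => /forallP/(_ i). Qed.

Lemma diagram_nonincr (i j : 'I_n) : i <= j -> (nu j <= nu i)%R.
Proof.
by case/andP: (diagramP nu) => _ /forallP/(_ i)/forallP/(_ j)/implyP; apply.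
Qed.

Lemma row_len_nonincr (i j : 'I_n) : i <= j -> row_len nu j <= row_len nu i.
Proof.
move=> le_ij; rewrite /row_len.
have := diagram_nonincr le_ij; have := diagram_ge0 i; have := diagram_ge0 j.
lia.
Qed.

Lemma lt_num_rows (i : 'I_n) : (nu i != 0%R) = (i < num_rows nu).
Proof.
apply: (@down_closed_card n (fun i => nu i != 0%R)) => {}i j /diagram_nonincr.
by have := diagram_ge0 i; have := diagram_ge0 j; lia.
Qed.

Lemma lt_col_len (j : nat) (i : 'I_n) : (j < row_len nu i) = (i < col_len nu j).
Proof.
apply: (@down_closed_card n (fun i => j < row_len nu i)) => {}i k.
move=> /row_len_nonincr; lia.
Qed.

Lemma col_len_num_rows (j : nat) : col_len nu j <= num_rows nu.
Proof.
apply: subset_leq_card; apply/fintype.subsetP => i; rewrite !inE /row_len; lia.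
Qed.

End Diagram.

(** * Cells of a filling and their order in the far-eastern reading *)

Section Filling.

Variables (n : nat) (nu : diagram n) (T : filling nu).

Lemma has_entry_fun (j : nat) (p q : 'I_n) x y :
  p = q :> nat -> has_entry T j p x -> has_entry T j q y -> x = y.
Proof. by move=> /val_inj ->; rewrite /has_entry => -> [->]. Qed.

Lemma has_entryP (j : nat) (p : 'I_n) :
  (exists x, has_entry T j p x) <-> p < col_len nu j.
Proof.
rewrite -lt_col_len /has_entry /entry; case: insubP => [c -> _ | /negbTE ->] /=.
  by split=> // _; eexists.
by split=> // -[].
Qed.

Lemma has_entry_lt (j : nat) (p : 'I_n) x :
  has_entry T j p x -> p < col_len nu j.
Proof. by move=> Tx; apply/has_entryP; exists x. Qed.

Lemma has_entry_sub (j j' : nat) (p q : 'I_n) x :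
  has_entry T j p x -> j' <= j -> q <= p -> exists y, has_entry T j' q y.
Proof.
move=> /has_entry_lt lt_p le_j le_q; apply/has_entryP.
by move: lt_p; rewrite -!lt_col_len => /(leq_ltn_trans le_j)/leq_trans; apply;
   apply: row_len_nonincr.
Qed.

Lemma has_entry_lt_num_rows (j : nat) (p : 'I_n) x :
  has_entry T j p x -> p < num_rows nu.
Proof. move=> /has_entry_lt; have := col_len_num_rows nu j; lia. Qed.

Lemma has_entry_lt_num_cols (j : nat) (p : 'I_n) x :
  has_entry T j p x -> j < num_cols nu.
Proof.
move=> /has_entry_lt; rewrite -lt_col_len => /leq_trans; apply.
exact: (@leq_bigmax _ (row_len nu) p).
Qed.

(** Smoothness constrains prefixes of the reading; this converts a letter of the prefix before a
    cell into a cell further right, or higher in the same column. *)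
Lemma FE_split (j : nat) (p : 'I_n) x : has_entry T j p x ->
  exists s1 s2, FE T = s1 ++ x :: s2 /\
    forall y, y \in s1 -> exists j' (q : 'I_n),
      has_entry T j' q y /\ (j < j' \/ j' = j /\ q < p).
Proof.
move=> Tx; have lt_j := has_entry_lt_num_cols Tx.
have splitC : rev (iota 0 (num_cols nu)) =
    rev (iota j.+1 (num_cols nu - j.+1)) ++ j :: rev (iota 0 j).
  rewrite -[in LHS](subnKC lt_j) iotaD rev_cat add0n.
  by rewrite -[in iota 0 _]addn1 iotaD rev_cat.
have splitR : enum 'I_n = take p (enum 'I_n) ++ p :: drop p.+1 (enum 'I_n).
  rewrite -[LHS](cat_take_drop p) (drop_nth p) ?size_enum_ord //.
  by rewrite nth_ord_enum.
exists (flatten [seq column T k | k <- rev (iota j.+1 (num_cols nu - j.+1))]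
        ++ pmap (fun q => entry T q j) (take p (enum 'I_n))).
exists (pmap (fun q => entry T q j) (drop p.+1 (enum 'I_n))
        ++ flatten [seq column T k | k <- rev (iota 0 j)]).
split.
  rewrite /FE splitC map_cat flatten_cat -catA; congr (_ ++ _) => /=.
  by rewrite {1}/column {1}splitR pmap_cat /= [entry T p j]Tx /= -catA.
move=> y; rewrite mem_cat => /orP[/flattenP[c /mapP[k kP ->]]|].
  rewrite /column mem_pmap => /mapP[q _ eqy]; exists k, q; split=> //; left.
  by move: kP; rewrite mem_rev mem_iota => /andP[].
rewrite mem_pmap => /mapP[q qP eqy]; exists j, q; split=> //; right; split=> //.
by move: qP; rewrite in_take ?mem_enum // index_enum_ord.
Qed.

End Filling.

(** * Letters that smoothness forces to be read earlier *)

Section Smoothness.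

Variable n : nat.

Lemma add_wordE (w : weight n) (s : seq (letter n)) (i : 'I_n) :
  (add_word w s i
     = w i + (count_mem (unb i) s)%:Z - (count_mem (bar i) s)%:Z)%R.
Proof.
elim: s w => [|x s IHs] w /=; first lia.
rewrite IHs ffunE; case: x => b k /=; rewrite !xpair_eqE /= eq_sym.
by case: b; case: eqP => _ /=; lia.
Qed.

(** [scanl] omits its starting value, so the empty prefix relies on [is_diagram w]. *)
Lemma smooth_prefix (w : weight n) (s1 s2 : seq (letter n)) :
  is_diagram w -> smooth w (s1 ++ s2) -> is_diagram (add_word w s1).
Proof.
elim: s1 w => [|x s1 IHs] w //= wP; rewrite /smooth /= => /andP[xP].
exact: IHs.
Qed.

Variables (mu nu : diagram n) (T : filling nu).
Hypothesis T_smooth : smooth mu (FE T).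

Lemma diagram_vanish (i : 'I_n) : num_rows mu <= i -> mu i = 0%R.
Proof. by rewrite leqNgt -lt_num_rows negbK => /eqP. Qed.

(** Once this letter is read, row [i] has a box, hence so has row [k] just above it. That row is
    empty in [mu], so its letter was added earlier. *)
Lemma unb_preceded (j : nat) (p i k : 'I_n) :
  has_entry T j p (unb i) -> i = k.+1 :> nat -> num_rows mu <= k ->
  exists j' (q : 'I_n),
    has_entry T j' q (unb k) /\ (j < j' \/ j' = j /\ q < p).
Proof.
move=> Ti eqi le_k; have [s1 [s2 [eqFE s1P]]] := FE_split Ti.
apply: s1P; move: T_smooth; rewrite eqFE => smoothT.
have /andP[/forallP/(_ i) w_ge0 _] := smooth_prefix (diagramP mu) smoothT.
move: smoothT; rewrite -cat_rcons => /(smooth_prefix (diagramP mu)).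
case/andP=> _ /forallP/(_ k)/forallP/(_ i)/implyP; rewrite eqi leqnSn.
move=> /(_ isT).
rewrite !add_wordE -cats1 !count_cat /= !xpair_eqE /= eqxx.
have -> : (i == k) = false by apply/negbTE/eqP => eqik; move: eqi; rewrite eqik; lia.
move: w_ge0; rewrite add_wordE -has_pred1 has_count (diagram_vanish le_k).
move: (count_mem (unb k) s1) (count_mem (unb i) s1) (count_mem (bar k) s1).
by move: (count_mem (bar i) s1) => *; lia.
Qed.

(** Row [i] is empty in [mu], so a box must have been added to it before one can be removed. *)
Lemma bar_preceded (j : nat) (p i : 'I_n) :
  has_entry T j p (bar i) -> num_rows mu <= i ->
  exists j' (q : 'I_n),
    has_entry T j' q (unb i) /\ (j < j' \/ j' = j /\ q < p).
Proof.
move=> Ti le_i; have [s1 [s2 [eqFE s1P]]] := FE_split Ti.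
apply: s1P; move: T_smooth; rewrite eqFE -cat_rcons.
move=> /(smooth_prefix (diagramP mu))/andP[/forallP/(_ i) + _].
rewrite add_wordE -cats1 !count_cat /= !xpair_eqE /= eqxx.
rewrite -has_pred1 has_count (diagram_vanish le_i).
by move: (count_mem (unb i) s1) (count_mem (bar i) s1) => *; lia.
Qed.

End Smoothness.

(** * Where n and its bar can occur *)

Section LastLetter.

Variables (n : nat) (mu nu : diagram n) (T : filling nu).

(* The common weakening of type C and type D semistandardness. *)
Definition weakly_semistandard : Prop :=
  (forall p j x y, has_entry T j p x -> has_entry T j.+1 p y -> le_C x y) /\
  (forall j (p q : 'I_n) x y, q = p.+1 :> nat ->
     has_entry T j p x -> has_entry T j q y -> lt_C x y || n_pair x y).

Lemma semistandard_C_weakly : semistandard_C T -> weakly_semistandard.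
Proof.
by case=> Trow Tcol; split=> // j p q x y /Tcol Tpq /Tpq{}Tpq /Tpq ->.
Qed.

Lemma semistandard_D_weakly : semistandard_D T -> weakly_semistandard.
Proof.
case=> Trow _ Tcol; split=> [p j x y Tx Ty | j p q x y eqq Tx Ty].
  by have /orP[|/andP[]] := Trow _ _ _ _ Tx Ty; rewrite /le_C => ->; rewrite ?orbT.
by have /orP[/andP[->]|->] := Tcol _ _ _ _ _ eqq Tx Ty; rewrite ?orbT.
Qed.

Hypothesis T_semistandard : weakly_semistandard.

Lemma row_bar_mono (p : 'I_n) (j j' : nat) x y :
  j <= j' -> has_entry T j p x -> has_entry T j' p y -> x.1 -> y.1.
Proof.
move=> le_j Tx; elim: j' le_j y => [|j' IHj'] le_j y Ty xb.
  by move: le_j Tx; rewrite leqn0 => /eqP ->; rewrite /has_entry Ty => -[->].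
case: (ltngtP j j'.+1) le_j => // [le_j _ | eqj _]; last first.
  by move: Tx; rewrite eqj /has_entry Ty => -[->].
have [z Tz] := has_entry_sub Ty (leqnSn j') (leqnn p).
have zb := IHj' le_j z Tz xb; have := T_semistandard.1 _ _ _ _ Tz Ty.
by rewrite /le_C; case: eqP => [<- // | _]; move: y z {Ty Tz} zb => [[] ?] [[] ?].
Qed.

(** Only the exceptional pair, bar n above n, could lead from a barred letter down to an unbarred
    one. Below any other barred letter the values strictly decrease, so n never returns. *)
Lemma column_bar_mono (j : nat) (p q : 'I_n) x y :
  p <= q -> has_entry T j p x -> has_entry T j q y ->
  x.1 -> ~~ is_n x -> y.1 && ~~ is_n y.
Proof.
move=> le_pq Tx Ty xb xn; case: q le_pq Ty => q /=.
elim: q y => [|q IHq] y ltq le_pq Ty.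
  have <- : x = y by apply: has_entry_fun Tx Ty => /=; lia.
  by rewrite xb xn.
case: (ltngtP p q.+1) le_pq => // [le_pq _ | eqp _]; last first.
  by have <- : x = y by [apply: has_entry_fun Tx Ty]; rewrite xb xn.
have [|z Tz] := @has_entry_sub _ _ _ j j _ (Ordinal (ltnW ltq)) _ Ty (leqnn j).
  exact: leqnSn.
have /andP[zb zn] := IHq z (ltnW ltq) le_pq Tz.
have := T_semistandard.2 j (Ordinal (ltnW ltq)) (Ordinal ltq) z y erefl Tz Ty.
rewrite /n_pair (negbTE zn) orbF /is_n /value.
move: y z {Ty Tz} zb zn => [[] y] [[] z] //=; rewrite /is_n /value /=.
by have := ltn_ord z; lia.
Qed.

Hypothesis T_smooth : smooth mu (FE T).
Hypothesis le_rows : num_rows mu + num_rows nu <= n.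

(* The two claims are proved together, following the far-eastern reading: an
   unbarred letter i in row p needs an earlier i - 1, which sits in a row >= p of
   a column further right unless i is small. *)
Lemma last_letter_bounds (j : nat) (p : 'I_n) x : has_entry T j p x ->
  (~~ x.1 -> x.2 <= num_rows mu + p) /\ ~~ (x.1 && is_n x).
Proof.
(* This measure increases along the reading: a column further right weighs at least [n] less, which
   outweighs any row index. *)
move eqd: ((num_cols nu - j) * n + p) => d.
elim/ltn_ind: d j p x eqd => d IHd j p x eqd Tx.
have {}IHd j' (q : 'I_n) y : has_entry T j' q y -> j < j' \/ j' = j /\ q < p ->
    (~~ y.1 -> y.2 <= num_rows mu + q) /\ ~~ (y.1 && is_n y).
  move=> Ty before; apply: (fun ltd => IHd _ ltd _ _ _ erefl Ty); rewrite -eqd.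
  have := has_entry_lt_num_cols Ty; have := ltn_ord q.
  case: before => [lt_j | [-> lt_q]] ltq lt_C; last by rewrite ltn_add2l.
  have -> : num_cols nu - j = (num_cols nu - j') + (j' - j) by lia.
  rewrite mulnDl -addnA ltn_add2l.
  apply: leq_trans (leq_addr _ _); apply: leq_trans ltq _.
  by apply: leq_pmull; lia.
have lt_p := has_entry_lt_num_rows Tx.
case: x Tx => [] [] i Tx; split=> //=.
- apply/negP; rewrite /is_n /value /= => /eqP eqi.
  have [|j' [q [Tq before]]] := bar_preceded T_smooth Tx; first by lia.
  (* The bound puts the earlier n in the last row of [nu], so not above row [p]; it lies in a column
     further right. *)
  have [/(_ isT) /= le_q _] := IHd _ _ _ Tq before.
  have lt_q := has_entry_lt_num_rows Tq.
  case: before => [lt_j | [eqj lt_qp]]; last lia.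
  have le_pq : p <= q by lia.
  have [y Ty] := has_entry_sub Tq (ltnW lt_j) (leqnn q).
  have /negP yu : ~~ y.1.
    by apply/negP => /(row_bar_mono (ltnW lt_j) Ty Tq).
  case: (ltngtP p q) le_pq => // [lt_pq _ | eqpq _]; last first.
    by apply: yu; move: Tx; rewrite (val_inj eqpq) /has_entry Ty => -[->].
  (* Column [j] is no help, as n may follow its own bar there. In column [j.+1] induction excludes
     bar n, so the bar passes down to row [q] and then right to the unbarred n. *)
  have [z Tz] := has_entry_sub Tq lt_j (ltnW lt_pq).
  have [t Tt] := has_entry_sub Tq lt_j (leqnn q).
  have zb := row_bar_mono (leqnSn j) Tx Tz isT.
  have [_ nz] := IHd _ _ _ Tz (or_introl (ltnSn j)).
  rewrite zb /= in nz.
  have /andP[tb _] := column_bar_mono (ltnW lt_pq) Tz Tt zb nz.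
  by have := row_bar_mono lt_j Tt Tq tb.
move=> _; rewrite leqNgt; apply/negP => lt_i.
have lt_in : i.-1 < n by have := ltn_ord i; lia.
have [||j' [q [Tq before]]] := unb_preceded T_smooth Tx (k := Ordinal lt_in).
- by rewrite /= prednK //; lia.
- by rewrite /=; lia.
have [/(_ isT) /= le_q _] := IHd _ _ _ Tq before.
have lt_j : j < j' by case: before => // -[]; lia.
have le_pq : p <= q by lia.
(* The right neighbour of the cell is either unbarred, and then too small by induction, or barred,
   and then its bar spreads right to column [j'] and down to the unbarred letter in row [q]. *)
have [y Ty] := has_entry_sub Tq lt_j le_pq.
have [y_le y_n] := IHd _ _ _ Ty (or_introl (ltnSn j)).
case yb: y.1; last first.
  have {}y_le : y.2 <= num_rows mu + p by apply: y_le; rewrite yb.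
  have := T_semistandard.1 _ _ _ _ Tx Ty.
  rewrite /le_C; case: eqP => [eqy | _] /=; first by rewrite -eqy /= in y_le; lia.
  by case: y yb {Ty y_n} y_le => [[] k] //= _; lia.
have [z Tz] := has_entry_sub Tq (leqnn j') le_pq.
have zb := row_bar_mono lt_j Ty Tz yb.
have [_ z_n] := IHd _ _ _ Tz (or_introl lt_j); rewrite zb /= in z_n.
by have := column_bar_mono le_pq Tz Tq zb z_n.
Qed.

Lemma no_bar_n (j : nat) (p : 'I_n) x :
  has_entry T j p x -> is_n x -> x.1 = false.
Proof.
by move=> /last_letter_bounds[_ +] xn; rewrite xn andbT => /negbTE.
Qed.

(** The bound gives n - 1 <= l(mu) + p, while p < l(nu) and l(mu) + l(nu) <= n; together they leave
    only equalities. *)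
Lemma n_in_last_row (j : nat) (p : 'I_n) x :
  has_entry T j p x -> is_n x -> p.+1 = num_rows nu /\ num_rows mu + p.+1 = n.
Proof.
move=> Tx xn; have [+ _] := last_letter_bounds Tx; rewrite (no_bar_n Tx xn).
move=> /(_ isT); have := has_entry_lt_num_rows Tx.
by move: xn; rewrite /is_n /value => /eqP; lia.
Qed.

Lemma no_n_pair (j j' : nat) (p q : 'I_n) x y :
  has_entry T j p x -> has_entry T j' q y -> n_pair x y = false.
Proof.
move=> Tx Ty; apply/negbTE; apply/negP => /and3P[xn yn] /eqP[].
have := no_bar_n Tx xn; have := no_bar_n Ty yn.
move: xn yn; rewrite /is_n /value; case: x y {Tx Ty} => [b x] [c y] /=.
by move=> /eqP eqx /eqP eqy -> ->; congr pair; apply: val_inj => /=; lia.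
Qed.

(** The orders of types C and D differ only on the pair n, bar n, which [T] does not contain. *)
Lemma semistandard_CD : semistandard_C T <-> semistandard_D T.
Proof.
have ltE j j' (p q : 'I_n) x y : has_entry T j p x -> has_entry T j' q y ->
    lt_D x y = lt_C x y.
  move=> Tx Ty; rewrite /lt_D; case lt_xy: (lt_C x y) => //=.
  apply/negP => /andP[xn yn]; have := no_n_pair Tx Ty.
  rewrite /n_pair xn yn /= => /negbFE/eqP eqxy; move: lt_xy; rewrite eqxy.
  by case: y {Ty Tx yn eqxy} => [[] y] /=; rewrite ltnn.
split=> [[Trow Tcol] | [Trow _ Tcol]]; split.
- move=> p j x y Tx Ty; rewrite /le_D (ltE _ _ _ _ _ _ Tx Ty).
  exact: Trow Tx Ty.
- by move=> p j j' x y Tx Ty; rewrite (no_n_pair Tx Ty).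
- move=> j p q x y eqq Tx Ty; rewrite (ltE _ _ _ _ _ _ Tx Ty).
  by rewrite (Tcol _ _ _ _ _ eqq Tx Ty).
- move=> p j x y Tx Ty; rewrite /le_C -(ltE _ _ _ _ _ _ Tx Ty).
  exact: Trow Tx Ty.
- move=> j p q x y eqq Tx Ty; rewrite -(ltE _ _ _ _ _ _ Tx Ty).
  by have := Tcol _ _ _ _ _ eqq Tx Ty; rewrite (no_n_pair Tx Ty) orbF.
Qed.

End LastLetter.

(** * From violations of the type C conditions to violations of (D1) and (D4) *)

Section TypeC.

Variables (n : nat) (nu : diagram n) (T : filling nu).
Hypothesis T_C : semistandard_C T.

(** Indexed by [nat] so that the lemmas on common values apply to columns; a missing cell gets 0,
    which is not the value of any letter. *)
Definition cell_value (j k : nat) : nat :=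
  oapp (fun x : letter n => value x.2) 0 (obind (entry T ^~ j) (insub k)).

Lemma cell_valueE (j : nat) (p : 'I_n) x :
  has_entry T j p x -> cell_value j p = value x.2.
Proof. by rewrite /has_entry /cell_value valK /= => ->. Qed.

Lemma bar_below (j : nat) (p q : 'I_n) x y : p <= q ->
  has_entry T j p x -> has_entry T j q y -> x.1 -> y.1.
Proof.
move=> le_pq Tx Ty xb; case: q le_pq Ty => q /=.
elim: q y => [|q IHq] y ltq le_pq Ty.
  by have <- : x = y by apply: has_entry_fun Tx Ty => /=; lia.
case: (ltngtP p q.+1) le_pq => // [le_pq _ | eqp _]; last first.
  by have <- : x = y by apply: has_entry_fun Tx Ty.
have [|z Tz] := @has_entry_sub _ _ _ j j _ (Ordinal (ltnW ltq)) _ Ty (leqnn j).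
  exact: leqnSn.
have zb := IHq z (ltnW ltq) le_pq Tz.
have := T_C.2 j (Ordinal (ltnW ltq)) (Ordinal ltq) z y erefl Tz Ty.
by move: y z {Ty Tz} zb => [[] y] [[] z].
Qed.

Lemma unb_above (j : nat) (q : 'I_n) b (k : nat) :
  has_entry T j q (unb b) -> k <= q ->
  exists (p a : 'I_n), [/\ p = k :> nat, has_entry T j p (unb a)
                         & cell_value j k = value a].
Proof.
move=> Tb le_k; have lt_k := leq_ltn_trans le_k (ltn_ord q).
have [[[] a] Ta] := @has_entry_sub _ _ _ j j _ (Ordinal lt_k) _ Tb (leqnn j) le_k.
  by have := bar_below (p := Ordinal lt_k) le_k Ta Tb isT.
by exists (Ordinal lt_k), a; split=> //; exact: cell_valueE Ta.
Qed.

Lemma bar_between (j : nat) (r s : 'I_n) b y (k : nat) :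
  has_entry T j r (bar b) -> has_entry T j s y -> r <= k <= s ->
  exists (p a : 'I_n), [/\ p = k :> nat, has_entry T j p (bar a)
                         & cell_value j k = value a].
Proof.
move=> Tb Ty /andP[le_rk le_ks]; have lt_k := leq_ltn_trans le_ks (ltn_ord s).
have [[[] a] Ta] := @has_entry_sub _ _ _ j j _ (Ordinal lt_k) _ Ty (leqnn j) le_ks.
  by exists (Ordinal lt_k), a; split=> //; exact: cell_valueE Ta.
by have := bar_below (q := Ordinal lt_k) le_rk Tb Ta isT.
Qed.

Lemma unb_increasing (j : nat) (q : 'I_n) b (k : nat) :
  has_entry T j q (unb b) -> k < q -> cell_value j k < cell_value j k.+1.
Proof.
move=> Tb lt_k; have [p [a [eqp Ta ->]]] := unb_above Tb (ltnW lt_k).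
have [p' [a' [eqp' Ta' ->]]] := unb_above Tb lt_k.
by apply: (T_C.2 _ _ _ _ _ _ Ta Ta'); rewrite eqp eqp'.
Qed.

Lemma bar_decreasing (j : nat) (r s : 'I_n) b y (k : nat) :
  has_entry T j r (bar b) -> has_entry T j s y -> r <= k < s ->
  cell_value j k.+1 < cell_value j k.
Proof.
move=> Tb Ty kP.
have [|p [a [eqp Ta ->]]] := @bar_between _ _ _ _ _ k Tb Ty; first lia.
have [|p' [a' [eqp' Ta' ->]]] := @bar_between _ _ _ _ _ k.+1 Tb Ty; first lia.
by apply: (T_C.2 _ _ _ _ _ _ Ta Ta'); rewrite eqp eqp'.
Qed.

(** If (C1) fails, the unbarred entries down to row [p] and the barred ones from row [q] to the
    bottom outnumber the values 1, ..., max(a, b). Their largest common value then violates (D1). *)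
Lemma KN_D1_C1 : KN_D1 T -> KN_C1 T.
Proof.
move=> D1 j p q a b Ta Tb; rewrite ltnNge; apply/negP => le_max.
have lt_q := has_entry_lt Tb.
have le_n : col_len nu j <= n by rewrite -[X in _ <= X]card_ord max_card.
have lt_s : (col_len nu j).-1 < n by have := ltn_ord q; lia.
have [|y Ty] := (has_entryP T j (Ordinal lt_s)).2; first by rewrite /=; lia.
have le_qs : q <= Ordinal lt_s by rewrite /=; lia.
have lt_pq : p < q.
  rewrite ltnNge; apply/negP => le_qp.
  by have := bar_below le_qp Tb Ta isT.
have [i [a0 [_ _ f0]]] := unb_above Ta (leq0n p).
have [|i' [b0 [_ _ gs]]] := @bar_between _ _ _ _ _ (Ordinal lt_s) Tb Ty.
  by rewrite le_qs leqnn.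
have [] := @top_common_value (cell_value j) (cell_value j) 0 p q
             (Ordinal lt_s) 1 (maxn (value a) (value b)) => //.
- by move=> k /andP[_]; apply: unb_increasing Ta.
- by move=> k; apply: bar_decreasing Tb Ty.
- by rewrite f0.
- by rewrite (cell_valueE Ta) /= leq_maxl.
- by rewrite gs.
- by rewrite (cell_valueE Tb) /= leq_maxr.
- by rewrite /=; lia.
move=> p1 [q1 [/andP[_ p1P] q1P eq_pq le_c]].
have [p2 [c [eqp2 Tc vc]]] := unb_above Ta p1P.
have [q2 [d [eqq2 Td vd]]] := bar_between Tb Ty q1P.
have eq_cd : d = c by apply: val_inj; move: eq_pq; rewrite vc vd /= => -[->].
rewrite eq_cd in Td; rewrite /= in q1P.
have lt_pq2 : p2 < q2 by lia.
by have := D1 j p2 q2 c lt_pq2 Tc Td; lia.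
Qed.

Hypothesis T_no_bar_n : forall j (p : 'I_n) (a : 'I_n),
  has_entry T j p (bar a) -> value a < n.

Lemma row_le_C (j j' : nat) (p : 'I_n) x y : j <= j' <= j.+1 ->
  has_entry T j p x -> has_entry T j' p y -> le_C x y.
Proof.
move=> /andP[le_j le_j'] Tx; have [-> | ->] : j' = j \/ j' = j.+1 by lia.
  by rewrite /has_entry Tx => -[->]; rewrite /le_C eqxx.
exact: T_C.1 Tx.
Qed.

(** If (C2) fails, rows [p..q] and [r..s] have too many entries for the values from min(a1, a2) to
    max(b1, b2). Nested common values a <= b then give a configuration violating (D4). *)
Lemma KN_D4_C2 : KN_D4 T -> KN_C2 T.
Proof.
move=> D4 j p q r s a1 b1 a2 b2 /andP[le_pq lt_qr] le_rs _ _ config.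
rewrite ltnNge; apply/negP => le_max.
have {}le_max : maxn (value b1) (value b2)
    <= minn (value a1) (value a2) + (q - p) + (s - r) by lia.
(* [jb] is the column that holds both b1 and the bar of b2. *)
have {config} [jb [jbP Ta1 Tb1 Tb2 Ta2]] : exists jb,
    [/\ jb = j \/ jb = j.+1, has_entry T j p (unb a1), has_entry T jb q (unb b1),
        has_entry T jb r (bar b2) & has_entry T j.+1 s (bar a2)].
  by case: config => -[? ? ? ?]; [exists j.+1 | exists j]; split; auto.
have [le_jb jb_le] : j <= jb <= j.+1 /\ jb <= j.+1 <= jb.+1 by lia.
have [le_j le_js] : j <= jb /\ jb <= j.+1 by lia.
(* Comparison along rows shows that column [j] is unbarred down to row [q] and column [j.+1] is
   barred from row [r] to row [s]; these strips supply a and its bar. *)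
have [[[] b0] Tb0] := has_entry_sub Tb1 le_j (leqnn q).
  by have := row_le_C le_jb Tb0 Tb1.
have [y Ty] := has_entry_sub Ta2 le_js (leqnn s).
have [[[] a0] Ta0] := has_entry_sub Ta2 (leqnn j.+1) le_rs; last first.
  by have := row_le_C jb_le Tb2 Ta0.
have [] := @nested_common_values (cell_value j) (cell_value jb)
  (cell_value j.+1) (cell_value jb) p q r s _ _ le_pq le_rs
  _ _ _ _ _ _ _ _ _ _ le_max => //.
- by move=> k /andP[_]; apply: unb_increasing Tb0.
- by move=> k /andP[_]; apply: unb_increasing Tb1.
- by move=> k; apply: bar_decreasing Ta0 Ta2.
- by move=> k; apply: bar_decreasing Tb2 Ty.
- move=> k /andP[_ le_kq]; have [i [c [eqi Tc ->]]] := unb_above Tb0 le_kq.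
  have [i' [d [eqi' Td ->]]] := unb_above Tb1 le_kq.
  have eqii : i' = i by apply: val_inj; rewrite /= eqi eqi'.
  rewrite eqii in Td; have := row_le_C le_jb Tc Td.
  by rewrite /le_C => /orP[/eqP[->] // | /ltnW].
- move=> k kP; have [i [c [eqi Tc ->]]] := bar_between Ta0 Ta2 kP.
  have [i' [d [eqi' Td ->]]] := bar_between Tb2 Ty kP.
  have eqii : i' = i by apply: val_inj; rewrite /= eqi eqi'.
  rewrite eqii in Td; have := row_le_C jb_le Td Tc.
  by rewrite /le_C => /orP[/eqP[->] // | /ltnW].
- by rewrite (cell_valueE Ta1) geq_minl.
- by rewrite (cell_valueE Tb1) leq_maxl.
- by rewrite (cell_valueE Ta2) geq_minr.
- by rewrite (cell_valueE Tb2) leq_maxr.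
move=> p' [q' [r' [s' [[p'P q'P] [r'P s'P] eqa eqb le_ab]]]].
have le_p'q : p' <= q by lia.
have r'P' : r <= r' <= s by lia.
have s'P' : r <= s' <= s by lia.
have [p2 [a [eqp2 Ta va]]] := unb_above Tb0 le_p'q.
have [q2 [b [eqq2 Tb vb]]] := unb_above Tb1 q'P.
have [r2 [b' [eqr2 Tb' vb']]] := bar_between Tb2 Ty r'P'.
have [s2 [a' [eqs2 Ta' va']]] := bar_between Ta0 Ta2 s'P'.
have eq_a : a' = a by apply: val_inj; move: eqa; rewrite va va' /= => -[->].
have eq_b : b' = b by apply: val_inj; move: eqb; rewrite vb vb' /= => -[->].
rewrite {}eq_a {a'} in Ta' va'; rewrite {}eq_b {b'} in Tb' vb'.
(* (D4) only covers b < n; the common value b also occurs barred, so it is not n. *)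
have lt_b := T_no_bar_n Tb'.
have : q2 - p2 + (s2 - r2) < value b - value a; last by lia.
apply: (D4 j); [lia | lia | lia |].
by case: jbP Tb Tb' => -> Tb Tb'; [right | left].
Qed.

End TypeC.

(** * The two inclusions, condition by condition *)

Theorem theorem9p4 (n : nat) (lam mu nu : diagram n) :
  (num_rows mu + num_rows nu <= n)%N ->
  B_so nu mu lam = B_sp nu mu lam.
Proof.
move=> le_rows; apply/seteqP; split=> T.
- move=> [[T_ss TKN] [T_smooth T_lam]]; split=> //.
  have T_w := semistandard_D_weakly T_ss.
  have T_C := (semistandard_CD T_w T_smooth le_rows).2 T_ss.
  have [[D1 D2 D4] _] := TKN.
  split=> //; first exact: KN_D1_C1.
  apply: KN_D4_C2 => // j p a Ta.
  rewrite ltn_neqAle ltn_ord andbT; apply/negP => an.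
  by have := no_bar_n T_w T_smooth le_rows Ta an.
move=> [[T_ss C1 C2] [T_smooth T_lam]]; split=> //.
have T_w := semistandard_C_weakly T_ss.
have n_row := n_in_last_row T_w T_smooth le_rows.
have no_pair := no_n_pair T_w T_smooth le_rows.
split; first exact/(semistandard_CD T_w T_smooth le_rows).
split; split.
- by move=> j p q i lt_pq Ti Tbi; have := C1 j p q i i Ti Tbi; lia.
(* A column of length n forces l(nu) = n, so the letter n is its n-th entry: the difference in (D2)
   is 0, even as an unbarred n requires. *)
- move=> j p x col_n Tx xn; have [eqp _] := n_row _ _ _ Tx xn.
  have := col_len_num_rows nu j; have := ltn_ord p.
  rewrite (no_bar_n T_w T_smooth le_rows Tx xn) => *.
  by have -> : n - p.+1 = 0 by lia.
- move=> j p q r s a b lt_pqr le_rs /andP[le_ab _] config.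
  have := C2 j p q r s a b a b lt_pqr le_rs le_ab le_ab config.
  by rewrite maxnn minnn.
- move=> j p q r s a u v _ _ _ _ uv config; suff: n_pair u v = false by rewrite uv.
  by case: config => -[_ Tu Tv _]; apply: no_pair Tu Tv.
(* (D6) and (D7) concern letters n or bar n in two different rows, but these can only lie in the
   last row of [nu]. *)
- move=> j p s u v lt_ps un vn [Tu Tv].
  have [eqp _] := n_row _ _ _ Tu un; have := has_entry_lt_num_rows Tv; lia.
- move=> j p q r s a u v lt_pqr _ _ un vn _ Tu Tv.
  have [eqr _] := n_row _ _ _ Tu un; have [eqq _] := n_row _ _ _ Tv vn; lia.
Qed.
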